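(* Let $b$ be a virtual braid diagram of degree $n$ with OU matrix $M(b)=(M_{ij}(b))$. If $$\sum_{j=1}^n M_{kj}(b)=\sum_{i=1}^n M_{ik}(b)\quad\text{for all } k\in\{1,2,\dots,n\},$$ then the closure of $b$ admits an up-down coloring.
   Context: A virtual braid diagram of degree $n$ consists of $n$ strands in $\mathbb{R}^2$, each running monotonically from a top horizontal bar to a bottom horizontal bar, whose crossings are positive ($\sigma_i$), negative ($\sigma_i^{-1}$) or virtual ($v_i$) crossings ($1\le i\le n-1$) between the strands in positions $i$ and $i+1$; diagrams are considered up to planar isotopy fixing the bars pointwise (equivalently: finite words, read top to bottom, in $\sigma_i,\sigma_i^{-1},v_i$, identified only via exchanging adjacent letters whose indices differ by at least $2$). In $\sigma_i$ the strand going from position $i+1$ to position $i$ is over; in $\sigma_i^{-1}$ the strand going from position $i$ to position $i+1$ is over. The OU matrix $M(b)$ is the $n\times n$ matrix with zero diagonal whose $(i,j)$-component $M_{ij}(b)$, $i\ne j$, is the number of (classical) crossings of $b$ at which the $i$-th strand is over the $j$-th strand, where the $k$-th strand is the strand in the $k$-th position at the top. The closure of $b$ is the oriented virtual link diagram obtained by connecting, for each $i$, the $i$-th bottom endpoint to the $i$-th top endpoint by parallel arcs without introducing crossings, the strands being oriented downward. An edge of an oriented virtual link diagram is a segment between consecutive classical crossings along a component. An up-down coloring of an oriented virtual link diagram is an assignment of integers to its edges such that, traveling along the orientation, the integer increases by $1$ each time one passes through a classical crossing as the over-strand and decreases by $1$ each time one passes through a classical crossing as the under-strand (virtual crossings cause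 no change). *)

(* Defs.v *)
From HB Require Import structures.
From mathcomp Require Import all_boot all_order all_algebra all_fingroup.

Set Implicit Arguments.
Unset Strict Implicit.
Unset Printing Implicit Defensive.

Import GRing.Theory.

Variant crossing_kind := Positive | Negative | Virtual.

(* The two incoming branches of a crossing are labelled by booleans: when both
   branches run downward, [false] enters from the upper left and [true] from
   the upper right. So [true] is over at a positive crossing and [false] is
   over at a negative one. *)
Definition over_side (k : crossing_kind) : option bool :=
  match k with
  | Positive => Some true
  | Negative => Some false
  | Virtual => None
  end.

(* Combinatorial data of an oriented virtual link diagram. Finitely many
   points other than crossings are marked on the curves, at least one on each
   circle and on each arc between consecutive (classical or virtual)
   crossings; [next_point p] is the marked point that follows [p] along the
   orientation, and at most one crossing is passed between them. [entry (c,
   s)] is the last marked point before [c] on its incoming branch [s];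
   clockwise around [c] one finds entry (c, false), entry (c, true),
   next_point (entry (c, false)) and next_point (entry (c, true)). *)
Record vlink_diagram := VLinkDiagram {
  point : finType;
  crossing : finType;
  kind : crossing -> crossing_kind;
  next_point : point -> point;
  entry : crossing * bool -> point;
  next_point_inj : injective next_point;
  entry_inj : injective entry
}.

Section UpDownColoring.
Variable D : vlink_diagram.

Definition classical (c : crossing D) : bool := over_side (kind c).

Definition unbroken (p : point D) : bool :=
  [forall c, forall s, classical c ==> (entry (c, s) != p)].

(* [p] and [q] are neighbours, with no classical crossing between them. *)
Definition adjacent : rel (point D) :=
  [rel p q | (next_point p == q) && unbroken p
          || (next_point q == p) && unbroken q].

(* An edge is identified with the set of marked points lying on it. A component
   without classical crossings is a single closed edge. *)
Definition edge_set (p : point D) : {set point D} :=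
  [set q | connect adjacent p q].

Definition edge : Type := {E : {set point D} | E \in codom edge_set}.

Definition edge_of (p : point D) : edge :=
  exist _ (edge_set p) (codom_f edge_set p).

Definition up_down_coloring (f : edge -> int) : Prop :=
  forall (c : crossing D) (s : bool), over_side (kind c) = Some s ->
    let over := entry (c, s) in
    let under := entry (c, ~~ s) in
    (f (edge_of (next_point over)) = f (edge_of over) + 1)%R /\
    (f (edge_of (next_point under)) = f (edge_of under) - 1)%R.

End UpDownColoring.

Definition admits_up_down_coloring (D : vlink_diagram) : Prop :=
  exists f : edge D -> int, up_down_coloring f.

(* Positions and strands are numbered from 0: for i : 'I_n.-1, the letters
   (Positive, i), (Negative, i) and (Virtual, i) are sigma_(i+1), its inverse
   and v_(i+1). Words are representatives of diagrams up to exchange of distant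
   letters, and are read from top to bottom. *)
Definition letter (n : nat) : Type := (crossing_kind * 'I_n.-1)%type.
Definition vbraid (n : nat) : Type := seq (letter n).

Section VirtualBraid.
Variable n : nat.

Fact succ_pos_proof (i : 'I_n.-1) : i.+1 < n.
Proof. by rewrite -ltn_predRL. Qed.

Definition side_pos (i : 'I_n.-1) (s : bool) : 'I_n :=
  if s then Ordinal (succ_pos_proof i) else widen_ord (leq_pred n) i.

Fact side_pos_inj (i : 'I_n.-1) : injective (side_pos i).
Proof.
by case=> [] [] //= /(congr1 val) /= /eqP;
  rewrite ?(gtn_eqF (ltnSn i)) ?(ltn_eqF (ltnSn i)).
Qed.

Definition letter_perm (x : letter n) : 'S_n :=
  tperm (side_pos x.2 false) (side_pos x.2 true).

Variable b : vbraid n.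

Definition letter_at (t : 'I_(size b)) : letter n := tnth (in_tuple b) t.

(* Position, just before the t-th letter, of the strand that starts at the
   k-th position at the top. *)
Definition position (t : nat) (k : 'I_n) : 'I_n :=
  foldl (fun p x => letter_perm x p) k (take t b).

Definition is_over_at (i j : 'I_n) (t : 'I_(size b)) : bool :=
  let x := letter_at t in
  if over_side x.1 is Some s then
    (position t i == side_pos x.2 s) && (position t j == side_pos x.2 (~~ s))
  else false.

Definition OU_matrix : 'M[nat]_n :=
  \matrix_(i, j) if i == j then 0 else #|[set t | is_over_at i j t]|.

(* The marked point (p, t) is at position p, just before the t-th letter; for
   t = size b it is the p-th bottom endpoint, which is followed by the p-th top
   endpoint (p, 0). [lift ord_max t] and [lift ord0 t] are the levels t and
   t + 1. *)
Definition closure_next (x : 'I_n * 'I_(size b).+1) : 'I_n * 'I_(size b).+1 :=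
  if unlift ord_max x.2 is Some t then
    (letter_perm (letter_at t) x.1, lift ord0 t)
  else (x.1, ord0).

Definition closure_entry (y : 'I_(size b) * bool) : 'I_n * 'I_(size b).+1 :=
  (side_pos (letter_at y.1).2 y.2, lift ord_max y.1).

Fact closure_next_inj : injective closure_next.
Proof.
move=> [p t] [q u]; rewrite /closure_next /=.
case: unliftP => [t' ->|->]; case: unliftP => [u' ->|->] //=.
- move=> E; have /lift_inj etu := congr1 snd E.
  by move: (congr1 fst E); rewrite /= etu => /perm_inj ->.
- by case=> ->.
Qed.

Fact closure_entry_inj : injective closure_entry.
Proof.
move=> [t s] [u r] E; have /lift_inj /= etu := congr1 snd E.
by move: (congr1 fst E); rewrite /= etu => /side_pos_inj ->.
Qed.

Definition vbraid_closure : vlink_diagram :=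
  @VLinkDiagram ('I_n * 'I_(size b).+1)%type 'I_(size b)
    (fun t => (letter_at t).1) closure_next closure_entry
    closure_next_inj closure_entry_inj.

End VirtualBraid.

(* Main.v *)
(** Give each point of a strand of the braid the number of over-passages minus
    the number of under-passages made by the strand since the top. This obeys
    the crossing rule and starts at 0 on every strand; on the k-th strand it
    ends at the k-th row sum minus the k-th column sum of the OU matrix, which
    is 0 by hypothesis, so it descends to the closure. *)
Require Import Defs.
From mathcomp Require Import all_boot all_algebra.
From mathcomp Require Import all_fingroup zify.

Set Implicit Arguments.
Unset Strict Implicit.
Unset Printing Implicit Defensive.

Import GRing.Theory.

Section PointColoring.
Variables (D : vlink_diagram) (g : point D -> int).

Hypothesis g_unbroken : forall p, unbroken p -> g (next_point p) = g p.

Lemma adjacent_eq (p q : point D) : adjacent p q -> g p = g q.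
Proof. by case/orP=> /andP[/eqP<- /g_unbroken]. Qed.

Lemma connect_adjacent_eq (p q : point D) : connect (@adjacent D) p q -> g p = g q.
Proof.
case/connectP=> s; elim: s p => [|r s IHs] p /= => [_ -> //|/andP[pr rs] qE].
by rewrite (adjacent_eq pr); apply: IHs.
Qed.

(** Any point of the edge may be picked, since [g] is constant along edges. The default 0 is never
    reached: an edge contains the point that defines it. *)
Definition edge_value (E : edge D) : int :=
  if [pick p in sval E] is Some p then g p else 0%R.

Lemma edge_value_edge_of (p : point D) : edge_value (edge_of p) = g p.
Proof.
rewrite /edge_value /=; case: pickP => [q|/(_ p)]; rewrite inE.
  by move/connect_adjacent_eq.
by rewrite connect0.
Qed.

Lemma point_coloring_admits :
  (forall c s, over_side (kind c) = Some s ->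
     g (next_point (entry (c, s))) = (g (entry (c, s)) + 1)%R /\
     g (next_point (entry (c, ~~ s))) = (g (entry (c, ~~ s)) - 1)%R) ->
  admits_up_down_coloring D.
Proof.
move=> g_cross; exists edge_value => c s cs /=; rewrite !edge_value_edge_of.
exact: g_cross.
Qed.

End PointColoring.

Section BraidHeight.
Variable n : nat.
Implicit Types (x : letter n) (p k : 'I_n) (b : vbraid n).
Local Open Scope ring_scope.

Definition crossing_step x p : int :=
  if over_side x.1 is Some s
  then (p == side_pos x.2 s)%:R - (p == side_pos x.2 (~~ s))%:R else 0.

(* A letter permutes positions by an involution, so [letter_perm x p] is also
   where the strand now at [p] was before [x]. *)
Definition height b : 'I_n -> int :=
  foldl (fun h x p => h (letter_perm x p) + crossing_step x (letter_perm x p))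
    (fun=> 0) b.

Lemma side_pos_eq (i : 'I_n.-1) s r : (side_pos i s == side_pos i r) = (s == r).
Proof. exact: inj_eq (@side_pos_inj n i) s r. Qed.

Lemma height_rcons b x p :
  height (rcons b x) (letter_perm x p) = height b p + crossing_step x p.
Proof. by rewrite /height foldl_rcons tpermK. Qed.

Lemma crossing_step_over x s :
  over_side x.1 = Some s -> crossing_step x (side_pos x.2 s) = 1.
Proof. by rewrite /crossing_step => ->; rewrite !side_pos_eq eqxx; case: s. Qed.

Lemma crossing_step_under x s :
  over_side x.1 = Some s -> crossing_step x (side_pos x.2 (~~ s)) = -1.
Proof. by rewrite /crossing_step => ->; rewrite !side_pos_eq eqxx; case: s. Qed.

Lemma crossing_step_eq0 x p :
  (forall s, over_side x.1 -> p != side_pos x.2 s) -> crossing_step x p = 0.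
Proof.
rewrite /crossing_step; case: (over_side _) => [s|] // np.
by rewrite !(negPf (np _ _)).
Qed.

Lemma take_letter_at b (t : 'I_(size b)) :
  take t.+1 b = rcons (take t b) (letter_at t).
Proof. by rewrite (take_nth (letter_at t)) // {2}/letter_at (tnth_nth (letter_at t)). Qed.

Lemma positionS b (t : 'I_(size b)) k :
  position b t.+1 k = letter_perm (letter_at t) (position b t k).
Proof. by rewrite /position take_letter_at foldl_rcons. Qed.

Lemma position_inj b t : injective (position b t).
Proof.
rewrite /position; elim/last_ind: (take t b) => [|w x IHw] k l //.
by rewrite !foldl_rcons => /perm_inj/IHw.
Qed.

(** Going back up through the letters from a position of strand [k] retraces that strand, so the
    recursion of [height] adds up the steps of [k] alone. *)
Lemma height_position b t k : (t <= size b)%N ->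
  height (take t b) (position b t k) =
  \sum_(u < size b | (u < t)%N) crossing_step (letter_at u) (position b u k).
Proof.
elim: t => [|t IHt] tb; first by rewrite take0 big_pred0.
pose u := Ordinal tb.
rewrite (positionS u) (take_letter_at u) height_rcons IHt ?(ltnW tb) //.
rewrite [RHS](bigD1 u) ?ltnSn //= addrC; congr (_ + _).
by apply: eq_bigl => v; rewrite ltnS -val_eqE /=; lia.
Qed.

(** A strand cannot be on both sides of a letter, so the count also gives 0 on the diagonal. *)
Lemma OU_matrixE b (i j : 'I_n) :
  OU_matrix b i j = (\sum_(t < size b) is_over_at i j t)%N.
Proof.
rewrite mxE -sum1dep_card big_mkcond /=; case: eqP => [<-|_].
  rewrite big1 // => t _; rewrite /is_over_at; case: over_side => [s|] //.
  by case: eqP => //= ->; rewrite side_pos_eq; case: s.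
by apply: eq_bigr => t _; case: is_over_at.
Qed.

(** At each level the strands occupy the positions bijectively. *)
Lemma sum_position_eq b t p : (\sum_(k < n) (position b t k == p) = 1)%N.
Proof.
have [q _ qK] : bijective (position b t) by apply: injF_bij; apply: position_inj.
rewrite (bigD1 (q p)) //= qK eqxx big1 // => k.
by apply: contraNeq; rewrite eqb0 negbK => /eqP kp;
  apply/eqP/(@position_inj b t); rewrite qK.
Qed.

Lemma sum_crossing_step b k :
  \sum_(t < size b) crossing_step (letter_at t) (position b t k) =
  (\sum_(j < n) OU_matrix b k j)%N%:Z - (\sum_(i < n) OU_matrix b i k)%N%:Z.
Proof.
under [X in X%:Z - _]eq_bigr do rewrite OU_matrixE.
under [X in _ - X%:Z]eq_bigr do rewrite OU_matrixE.
(* With the sum over letters outermost, the identity can be checked one letter at a time. *)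
rewrite exchange_big [X in _ - X%:Z]exchange_big /= -!natz !natr_sum -sumrB.
apply: eq_bigr => t _; rewrite /crossing_step /is_over_at.
case: over_side => [s|]; last by rewrite !big1.
congr (_%:R - _%:R).
  (* Exactly one strand is on the branch opposite to [k], so summing over the other strand leaves
     only the indicator that [k] is over (below: under). *)
  under eq_bigr do rewrite -mulnb.
  by rewrite -big_distrr /= sum_position_eq muln1.
under eq_bigr do rewrite -mulnb.
by rewrite -big_distrl /= sum_position_eq mul1n.
Qed.

Definition closure_height b (x : point (vbraid_closure b)) : int :=
  height (take x.2 b) x.1.

Lemma closure_height_next b p (t : 'I_(size b)) :
  closure_height (closure_next (p, lift ord_max t)) =
  @closure_height b (p, lift ord_max t) + crossing_step (letter_at t) p.
Proof.
by rewrite /closure_height /closure_next liftK [X in take X _]lift0 lift_max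
  take_letter_at height_rcons.
Qed.

Lemma height_bottom b p :
  (forall k, \sum_(j < n) OU_matrix b k j = \sum_(i < n) OU_matrix b i k)%N ->
  height b p = 0.
Proof.
move=> bal.
(* [q p] is the strand that ends at bottom position [p]. *)
have [q _ qK] : bijective (position b (size b)) by apply: injF_bij; apply: position_inj.
rewrite -(qK p) -{1}(take_size b) height_position //.
under eq_bigl do rewrite ltn_ord.
by rewrite sum_crossing_step bal subrr.
Qed.

End BraidHeight.

Theorem corollary5p7 (n : nat) (b : vbraid n) :
  (forall k : 'I_n,
      \sum_(j < n) OU_matrix b k j = \sum_(i < n) OU_matrix b i k) ->
  admits_up_down_coloring (vbraid_closure b).
Proof.
move=> bal; apply: (@point_coloring_admits _ (@closure_height n b)).
  (* A point is either just above a letter or a bottom endpoint. In the first case, being unbroken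
     rules out both branches of a classical crossing, so the step is 0. *)
  case=> p l unb; case: (unliftP ord_max l) unb => [t|] -> unb.
    rewrite /= closure_height_next crossing_step_eq0 ?addr0 // => s cl.
    move/forallP/(_ t)/forallP/(_ s)/implyP/(_ cl): unb.
    by apply: contraNneq => ->.
  (* A bottom endpoint is followed by a top endpoint, of height 0; the equality of row and column
     sums enters here. *)
  rewrite /closure_height /= /closure_next unlift_none /= take0.
  by rewrite take_size [RHS]height_bottom.
move=> t s ts; rewrite /= !closure_height_next.
by rewrite crossing_step_over // crossing_step_under.
Qed.
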